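(* Let $\Sigma$ be a finite first-order signature, $\mathcal{T}$ a $\Sigma$-theory, and $\mathcal{C}$ a class of $\Sigma$-structures. Let $\mathcal{L}_{\mathcal{C}}$ be the $\mathcal{T}$-language of all $\mathcal{T}$-words $\langle\sigma_0,\ldots,\sigma_{n-1}\rangle$ such that $\sigma_i\in\mathcal{C}$ for all $i$. If $\mathcal{C}$ is definable by an existential second-order $\Sigma$-sentence, i.e. there is a sentence $\exists P_1\ldots\exists P_n\,\psi$ with $\psi$ a first-order sentence over $\Sigma\cup\{P_1,\ldots,P_n\}$ such that a $\Sigma$-structure belongs to $\mathcal{C}$ iff it satisfies $\exists P_1\ldots\exists P_n\,\psi$, then $\mathcal{L}_{\mathcal{C}}$ is $\mathcal{T}$-regular.
   Context: Signatures are multi-sorted first-order signatures in which every symbol is marked either rigid or non-rigid. For a signature $\Sigma$, $\Sigma'$ denotes the signature obtained from $\Sigma$ by replacing each non-rigid symbol $s$ by a fresh primed copy $s'$ (rigid symbols are kept); for a $\Sigma$-structure $\sigma$, $\sigma'$ denotes the corresponding renamed $\Sigma'$-structure. For structures over pairwise disjoint signatures with the same sort domains, $\rho\cup\sigma\cup\tau'$ denotes the combined structure over the union of the signatures. A $\Sigma$-theory $\mathcal{T}$ is a set of $\Sigma$-sentences; $[\![\mathcal{T}]\!]$ is the set of all $\Sigma$-structures with finite or countably infinite domains that satisfy $\mathcal{T}$. A $\mathcal{T}$-word is a finite sequence $\bar\sigma=\langle\sigma_0,\ldots,\sigma_{n-1}\rangle$ ($n\ge 0$) of elements of $[\![\mathcal{T}]\!]$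 such that for every sort $S$ and every rigid symbol $s$ of $\Sigma$, $S^{\sigma_i}=S^{\sigma_j}$ and $s^{\sigma_i}=s^{\sigma_j}$ for all $i,j$. $[\![\mathcal{T}]\!]^*$ is the set of all $\mathcal{T}$-words; a $\mathcal{T}$-language is a subset of $[\![\mathcal{T}]\!]^*$. A first-order automaton is a tuple $\mathcal{A}=\langle\Sigma,\Gamma,\phi_0,\phi_T,\phi_F\rangle$ where $\Sigma$ (word signature) and $\Gamma$ (state signature) are finite disjoint signatures, $\phi_0$ and $\phi_F$ are first-order $\Gamma$-sentences, and $\phi_T$ is a first-order $(\Gamma\cup\Sigma\cup\Gamma')$-sentence. Given a $\mathcal{T}$-word $\bar\sigma=\langle\sigma_0,\ldots,\sigma_{n-1}\rangle$, a $\mathcal{T}$-run of $\mathcal{A}$ induced by $\bar\sigma$ is a sequence $\langle\rho_0,\ldots,\rho_n\rangle$ of $\Gamma$-structures such that $S^{\rho_i}=S^{\sigma_0}$ for every sort $S$ and every $i$, rigid symbols of $\Gamma$ are interpreted identically in all $\rho_i$, $\rho_0\models\phi_0$, and $\rho_i\cup\sigma_i\cup\rho'_{i+1}\models\phi_T$ for all $0\le i<n$. $\mathcal{A}$ $\mathcal{T}$-accepts $\bar\sigma$ iff some such run satisfies $\rho_n\models\phi_F$. $\mathcal{L}_{\mathcal{T}}(\mathcal{A})$ is the set of $\mathcal{T}$-words $\mathcal{T}$-accepted by $\mathcal{A}$. A $\mathcal{T}$-language $L$ is $\mathcal{T}$-regular iff $L=\mathcal{L}_{\mathcal{T}}(\mathcal{A})$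 for some first-order automaton $\mathcal{A}$ with word signature $\Sigma$. *)

(* Defs.v *)
From Stdlib Require List.
From mathcomp Require Import all_boot.

Set Implicit Arguments.
Unset Strict Implicit.
Unset Printing Implicit Defensive.

(* Finite multi-sorted first-order signatures over a finite set of sorts [srt].
   Constants are function symbols without arguments.  Signatures that are to be
   combined share [srt]. *)
Record signature (srt : finType) := Signature {
  fsym : finType;
  fargs : fsym -> seq srt;
  fres : fsym -> srt;
  frigid : fsym -> bool;
  psym : finType;
  pargs : psym -> seq srt;
  prigid : psym -> bool }.

(* Symbols have no names here: the union takes the disjoint sum of the symbol
   sets, so its two arguments are disjoint by construction. *)
Definition sig_union (srt : finType) (Sg1 Sg2 : signature srt) :
    signature srt :=
  {| fsym := (fsym Sg1 + fsym Sg2)%type;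
     fargs f := match f with inl g => fargs g | inr g => fargs g end;
     fres f := match f with inl g => fres g | inr g => fres g end;
     frigid f := match f with inl g => frigid g | inr g => frigid g end;
     psym := (psym Sg1 + psym Sg2)%type;
     pargs p := match p with inl q => pargs q | inr q => pargs q end;
     prigid p := match p with inl q => prigid q | inr q => prigid q end |}.

(* The symbols of Sg' that are not already in Sg, i.e. the primed copies of the
   non-rigid symbols of Sg. *)
Definition sig_primed (srt : finType) (Sg : signature srt) : signature srt :=
  {| fsym := {f : fsym Sg | ~~ frigid f};
     fargs f := fargs (val f);
     fres f := fres (val f);
     frigid f := false;
     psym := {p : psym Sg | ~~ prigid p};
     pargs p := pargs (val p);
     prigid p := false |}.

(* Ga \cup Sg \cup Ga': the rigid symbols of Ga, common to Ga and Ga', occur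
   once. *)
Definition sig_step (srt : finType) (Ga Sg : signature srt) : signature srt :=
  sig_union (sig_union Ga Sg) (sig_primed Ga).

(* The signature {P_1, ..., P_n} of predicate symbols of arities [ar]. The
   rigidity mark plays no role in the satisfaction of sentences. *)
Definition sig_preds (srt : finType) (n : nat) (ar : 'I_n -> seq srt) :
    signature srt :=
  {| fsym := void;
     fargs f := match f with end;
     fres f := match f with end;
     frigid f := match f with end;
     psym := 'I_n;
     pargs := ar;
     prigid p := false |}.

(* Formulas with equality, with well-sorted de Bruijn variables: the context
   [c] lists the sorts of the variables that may occur free. *)
Inductive var (srt : finType) : seq srt -> srt -> Type :=
| VarO s c : var (s :: c) s
| VarS s t c : var c s -> var (t :: c) s.

Inductive term (srt : finType) (Sg : signature srt) (c : seq srt) :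
    srt -> Type :=
| TVar s : var c s -> term Sg c s
| TApp (f : fsym Sg) : terms Sg c (fargs f) -> term Sg c (fres f)
with terms (srt : finType) (Sg : signature srt) (c : seq srt) :
    seq srt -> Type :=
| TNil : terms Sg c [::]
| TCons s ss : term Sg c s -> terms Sg c ss -> terms Sg c (s :: ss).

Inductive formula (srt : finType) (Sg : signature srt) : seq srt -> Type :=
| FFalse c : formula Sg c
| FEq c s : term Sg c s -> term Sg c s -> formula Sg c
| FPred c (p : psym Sg) : terms Sg c (pargs p) -> formula Sg c
| FNot c : formula Sg c -> formula Sg c
| FAnd c : formula Sg c -> formula Sg c -> formula Sg c
| FOr c : formula Sg c -> formula Sg c -> formula Sg c
| FImp c : formula Sg c -> formula Sg c -> formula Sg c
| FAll c s : formula Sg (s :: c) -> formula Sg c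
| FEx c s : formula Sg (s :: c) -> formula Sg c.

Definition sentence (srt : finType) (Sg : signature srt) : Type :=
  formula Sg [::].

(* As usual in first-order logic, domains are non-empty. *)
Record domain (srt : finType) := Domain {
  carrier :> srt -> Type;
  carrier_inhabited : forall s, inhabited (carrier s) }.

Fixpoint tup (srt : finType) (D : srt -> Type) (ss : seq srt) : Type :=
  if ss is s :: ss' then (D s * tup D ss')%type else unit.

Record interpretation (srt : finType) (Sg : signature srt) (D : domain srt) :=
  Interpretation {
    fint : forall f : fsym Sg, tup D (fargs f) -> D (fres f);
    pint : forall p : psym Sg, tup D (pargs p) -> Prop }.

Record structure (srt : finType) (Sg : signature srt) := Structure {
  dom : domain srt;
  interp : interpretation Sg dom }.

Fixpoint lookup (srt : finType) (D : srt -> Type) (c : seq srt) (s : srt)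
    (x : var c s) : tup D c -> D s :=
  match x in var c s return tup D c -> D s with
  | VarO _ _ => fun e => e.1
  | VarS _ _ _ y => fun e => lookup y e.2
  end.

Fixpoint eval (srt : finType) (Sg : signature srt) (D : domain srt)
    (I : interpretation Sg D) (c : seq srt) (e : tup D c) (s : srt)
    (t : term Sg c s) {struct t} : D s :=
  match t in term _ _ s return D s with
  | TVar _ x => lookup x e
  | TApp f ts => fint I (evals I e ts)
  end
with evals (srt : finType) (Sg : signature srt) (D : domain srt)
    (I : interpretation Sg D) (c : seq srt) (e : tup D c) (ss : seq srt)
    (ts : terms Sg c ss) {struct ts} : tup D ss :=
  match ts in terms _ _ ss return tup D ss with
  | TNil => tt
  | TCons _ _ t us => (eval I e t, evals I e us)
  end.

Fixpoint sat (srt : finType) (Sg : signature srt) (D : domain srt)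
    (I : interpretation Sg D) (c : seq srt) (phi : formula Sg c) :
    tup D c -> Prop :=
  match phi in formula _ c return tup D c -> Prop with
  | FFalse _ => fun _ => False
  | FEq _ _ t u => fun e => eval I e t = eval I e u
  | FPred _ p ts => fun e => pint I (evals I e ts)
  | FNot _ f => fun e => ~ sat I f e
  | FAnd _ f g => fun e => sat I f e /\ sat I g e
  | FOr _ f g => fun e => sat I f e \/ sat I g e
  | FImp _ f g => fun e => sat I f e -> sat I g e
  | FAll c s f => fun e => forall x : D s, sat I f ((x, e) : tup D (s :: c))
  | FEx c s f => fun e => exists x : D s, sat I f ((x, e) : tup D (s :: c))
  end.

Definition models (srt : finType) (Sg : signature srt) (M : structure Sg)
    (phi : sentence Sg) : Prop :=
  sat (interp M) phi tt.

Definition int_union (srt : finType) (D : domain srt)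
    (Sg1 Sg2 : signature srt) (I1 : interpretation Sg1 D)
    (I2 : interpretation Sg2 D) : interpretation (sig_union Sg1 Sg2) D :=
  @Interpretation srt (sig_union Sg1 Sg2) D
    (fun f => match f with inl g => @fint _ _ _ I1 g
                         | inr g => @fint _ _ _ I2 g end)
    (fun p => match p with inl q => @pint _ _ _ I1 q
                         | inr q => @pint _ _ _ I2 q end).

Definition int_primed (srt : finType) (D : domain srt) (Sg : signature srt)
    (I : interpretation Sg D) : interpretation (sig_primed Sg) D :=
  @Interpretation srt (sig_primed Sg) D
    (fun f => @fint _ _ _ I (val f))
    (fun p => @pint _ _ _ I (val p)).

(* rho \cup sigma \cup tau', for interpretations over a common domain; the
   rigid symbols of Ga are read in rho, with which tau agrees on them. *)
Definition int_step (srt : finType) (D : domain srt) (Ga Sg : signature srt)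
    (rho : interpretation Ga D) (sigma : interpretation Sg D)
    (tau : interpretation Ga D) : interpretation (sig_step Ga Sg) D :=
  int_union (int_union rho sigma) (int_primed tau).

Definition agree_rigid (srt : finType) (Sg : signature srt) (D : domain srt)
    (I J : interpretation Sg D) : Prop :=
  (forall f : fsym Sg, frigid f ->
     forall xs : tup D (fargs f), fint I xs = fint J xs) /\
  (forall p : psym Sg, prigid p ->
     forall xs : tup D (pargs p), pint I xs <-> pint J xs).

Definition theory (srt : finType) (Sg : signature srt) : Type :=
  sentence Sg -> Prop.

Definition countable_domain (srt : finType) (D : domain srt) : Prop :=
  forall s, exists f : D s -> nat, injective f.

(* The set [[T]]. *)
Definition theory_models (srt : finType) (Sg : signature srt)
    (T : theory Sg) (M : structure Sg) : Prop :=
  countable_domain (dom M) /\ forall phi, T phi -> models M phi.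

(* That the structures of a sequence have the same sort domains is expressed by
   writing all of them over one domain [D]. *)
Definition is_word (srt : finType) (Sg : signature srt) (T : theory Sg)
    (w : seq (structure Sg)) : Prop :=
  (forall M, List.In M w -> theory_models T M) /\
  exists (D : domain srt) (n : nat) (sigma : n.-tuple (interpretation Sg D)),
    w = [seq Structure J | J <- sigma] /\
    forall i j : 'I_n, agree_rigid (tnth sigma i) (tnth sigma j).

Definition language (srt : finType) (Sg : signature srt) : Type :=
  seq (structure Sg) -> Prop.

Record automaton (srt : finType) (Sg : signature srt) := Automaton {
  state_sig : signature srt;
  phi_0 : sentence state_sig;
  phi_T : sentence (sig_step state_sig Sg);
  phi_F : sentence state_sig }.

(* [r] is a run of A induced by [w]; [widen_ord (leqnSn n) i] and [lift ord0 i]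
   are the indices i and i + 1 of 'I_n.+1.  For the empty word, the run consists
   of one structure, whose domain is arbitrary. *)
Definition is_run (srt : finType) (Sg : signature srt) (A : automaton Sg)
    (w : seq (structure Sg)) (r : seq (structure (state_sig A))) : Prop :=
  exists (D : domain srt) (n : nat) (sigma : n.-tuple (interpretation Sg D))
         (rho : n.+1.-tuple (interpretation (state_sig A) D)),
    w = [seq Structure J | J <- sigma] /\
    r = [seq Structure J | J <- rho] /\
    (forall i j : 'I_n.+1, agree_rigid (tnth rho i) (tnth rho j)) /\
    models (Structure (tnth rho ord0)) (phi_0 A) /\
    forall i : 'I_n,
      models
        (Structure (int_step (tnth rho (widen_ord (leqnSn n) i))
                             (tnth sigma i) (tnth rho (lift ord0 i))))
        (phi_T A).

Definition accepts (srt : finType) (Sg : signature srt) (A : automaton Sg)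
    (w : seq (structure Sg)) : Prop :=
  exists (r : seq (structure (state_sig A))) (M : structure (state_sig A)),
    is_run w (rcons r M) /\ models M (phi_F A).

Definition automaton_language (srt : finType) (Sg : signature srt)
    (T : theory Sg) (A : automaton Sg) : language Sg :=
  fun w => is_word T w /\ accepts A w.

Definition regular (srt : finType) (Sg : signature srt) (T : theory Sg)
    (L : language Sg) : Prop :=
  exists A : automaton Sg, forall w, L w <-> automaton_language T A w.

Definition class_language (srt : finType) (Sg : signature srt) (T : theory Sg)
    (C : structure Sg -> Prop) : language Sg :=
  fun w => is_word T w /\ forall M, List.In M w -> C M.

(* The second-order sentence exists P_1 ... P_n, psi. *)
Record eso_sentence (srt : finType) (Sg : signature srt) := ESO {
  eso_num : nat;
  eso_arity : 'I_eso_num -> seq srt;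
  eso_matrix : sentence (sig_union Sg (sig_preds eso_arity)) }.

Definition eso_models (srt : finType) (Sg : signature srt) (M : structure Sg)
    (Phi : eso_sentence Sg) : Prop :=
  exists P : interpretation (sig_preds (@eso_arity _ _ Phi)) (dom M),
    models (Structure (int_union (interp M) P)) (eso_matrix Phi).

Definition eso_definable (srt : finType) (Sg : signature srt)
    (C : structure Sg -> Prop) : Prop :=
  exists Phi : eso_sentence Sg, forall M, C M <-> eso_models M Phi.

(* Main.v *)
(* The automaton keeps the second-order witnesses P_1, ..., P_n, all non-rigid,
   as its state.  It guesses fresh witnesses at each position, and its
   transition formula is psi, read over the word letter and the current state;
   the primed state and the initial and final conditions are unconstrained. *)
Require Import Defs.
From mathcomp Require Import all_boot.

Set Implicit Arguments.
Unset Strict Implicit.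
Unset Printing Implicit Defensive.

(* Replaced symbols are given by term and formula constructors rather than by
   maps of symbols, so that no equality between arities has to be transported. *)
Record replacement (srt : finType) (S1 S2 : signature srt) := Replacement {
  rapp : forall (f : Defs.fsym S1) c, terms S2 c (fargs f) -> term S2 c (fres f);
  rpred : forall (p : psym S1) c, terms S2 c (pargs p) -> formula S2 c }.

Fixpoint rterm (srt : finType) (S1 S2 : signature srt)
    (h : replacement S1 S2) c s (t : term S1 c s) {struct t} : term S2 c s :=
  match t in term _ _ s return term S2 c s with
  | TVar _ x => TVar S2 x
  | TApp f ts => rapp h (rterms h ts)
  end
with rterms (srt : finType) (S1 S2 : signature srt)
    (h : replacement S1 S2) c ss (ts : terms S1 c ss) {struct ts} :
    terms S2 c ss :=
  match ts in terms _ _ ss return terms S2 c ss with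
  | TNil => TNil S2 c
  | TCons _ _ t us => TCons (rterm h t) (rterms h us)
  end.

Fixpoint rformula (srt : finType) (S1 S2 : signature srt)
    (h : replacement S1 S2) c (phi : formula S1 c) : formula S2 c :=
  match phi in formula _ c return formula S2 c with
  | FFalse c => FFalse S2 c
  | FEq _ _ t u => FEq (rterm h t) (rterm h u)
  | FPred _ p ts => rpred h (rterms h ts)
  | FNot _ f => FNot (rformula h f)
  | FAnd _ f g => FAnd (rformula h f) (rformula h g)
  | FOr _ f g => FOr (rformula h f) (rformula h g)
  | FImp _ f g => FImp (rformula h f) (rformula h g)
  | FAll _ _ f => FAll (rformula h f)
  | FEx _ _ f => FEx (rformula h f)
  end.

Record replacement_sound (srt : finType) (S1 S2 : signature srt)
    (h : replacement S1 S2) (D : domain srt) (I1 : interpretation S1 D)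
    (I2 : interpretation S2 D) : Prop := ReplacementSound {
  eval_rapp : forall f c (e : tup D c) (ts : terms S2 c (fargs f)),
    eval I2 e (rapp h ts) = fint I1 (evals I2 e ts);
  sat_rpred : forall p c (e : tup D c) (ts : terms S2 c (pargs p)),
    sat I2 (rpred h ts) e <-> pint I1 (evals I2 e ts) }.

Fixpoint eval_rterm (srt : finType) (S1 S2 : signature srt)
    (h : replacement S1 S2) (D : domain srt) (I1 : interpretation S1 D)
    (I2 : interpretation S2 D) (hI : replacement_sound h I1 I2)
    c (e : tup D c) s (t : term S1 c s) {struct t} :
  eval I2 e (rterm h t) = eval I1 e t
with evals_rterms (srt : finType) (S1 S2 : signature srt)
    (h : replacement S1 S2) (D : domain srt) (I1 : interpretation S1 D)
    (I2 : interpretation S2 D) (hI : replacement_sound h I1 I2)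
    c (e : tup D c) ss (ts : terms S1 c ss) {struct ts} :
  evals I2 e (rterms h ts) = evals I1 e ts.
Proof.
- case: t => [s' x|f ts] //=.
  by rewrite (eval_rapp hI) (evals_rterms _ _ _ _ _ _ _ hI).
- case: ts => [|s ss' t us] //=.
  by rewrite (eval_rterm _ _ _ _ _ _ _ hI) (evals_rterms _ _ _ _ _ _ _ hI).
Qed.

(** Induction on the formula with the environment left general: [replacement_sound] covers all
    contexts and environments at once, so it can be reused under quantifiers. *)
Lemma sat_rformula (srt : finType) (S1 S2 : signature srt)
    (h : replacement S1 S2) (D : domain srt) (I1 : interpretation S1 D)
    (I2 : interpretation S2 D) (hI : replacement_sound h I1 I2)
    c (phi : formula S1 c) (e : tup D c) :
  sat I2 (rformula h phi) e <-> sat I1 phi e.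
Proof.
elim: phi e => {c} [c|c s t u|c p ts|c f IHf|c f IHf g IHg|c f IHf g IHg
  |c f IHf g IHg|c s f IHf|c s f IHf] e /=.
- by [].
- by rewrite !(eval_rterm hI).
- by rewrite -(evals_rterms hI); apply: sat_rpred.
- by rewrite IHf.
- by rewrite IHf IHg.
- by rewrite IHf IHg.
- by rewrite IHf IHg.
- by split=> H x; apply/IHf.
- by split=> -[x /IHf H]; exists x.
Qed.

(** The matrix has word symbols on the left and witnesses on the right, while [sig_step] puts the
    state first; hence the swap. No symbol is sent to a primed copy, so the next state stays
    unconstrained. *)
Definition current_letter (srt : finType) (Sg Ga : signature srt) :
    replacement (sig_union Sg Ga) (sig_step Ga Sg) :=
  @Replacement srt (sig_union Sg Ga) (sig_step Ga Sg)
    (fun f => match f with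
      | inl g => fun c ts => @TApp srt (sig_step Ga Sg) c (inl (inr g)) ts
      | inr g => fun c ts => @TApp srt (sig_step Ga Sg) c (inl (inl g)) ts
      end)
    (fun p => match p with
      | inl q => fun c ts => @FPred srt (sig_step Ga Sg) c (inl (inr q)) ts
      | inr q => fun c ts => @FPred srt (sig_step Ga Sg) c (inl (inl q)) ts
      end).

Lemma current_letter_sound (srt : finType) (Sg Ga : signature srt)
    (D : domain srt) (sigma : interpretation Sg D)
    (rho tau : interpretation Ga D) :
  replacement_sound (current_letter Sg Ga) (int_union sigma rho)
    (int_step rho sigma tau).
Proof. by split=> -[]. Qed.

Definition eso_automaton (srt : finType) (Sg : signature srt)
    (Phi : eso_sentence Sg) : automaton Sg :=
  @Automaton srt Sg (sig_preds (@eso_arity _ _ Phi))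
    (FNot (FFalse _ _))
    (rformula (current_letter Sg _) (eso_matrix Phi))
    (FNot (FFalse _ _)).

Lemma models_eso_step (srt : finType) (Sg : signature srt)
    (Phi : eso_sentence Sg) (D : domain srt) (sigma : interpretation Sg D)
    (rho tau : interpretation (sig_preds (@eso_arity _ _ Phi)) D) :
  models (Structure (int_step rho sigma tau)) (phi_T (eso_automaton Phi)) <->
  models (Structure (int_union sigma rho)) (eso_matrix Phi).
Proof. exact: (sat_rformula (current_letter_sound sigma rho tau)). Qed.

Lemma In_map_tnth (A B : Type) (f : A -> B) n (t : n.-tuple A) (y : B) :
  List.In y [seq f x | x <- t] <-> exists i, y = f (tnth t i).
Proof.
(* Listing the letters by position moves membership to ['I_n], whose equality is decidable, unlike
   that of [B]. *)
have -> : [seq f x | x <- t] = [seq f (tnth t i) | i <- enum 'I_n].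
  by rewrite -{1}(map_tnth_enum t) -map_comp.
have memE (s : seq 'I_n) :
    List.In y [seq f (tnth t i) | i <- s] <->
    exists2 i, i \in s & y = f (tnth t i).
  elim: s => [|i s IHs] /=; first by split=> // -[].
  split=> [[<-|/IHs[j js ->]]|[j]].
  - by exists i; rewrite ?mem_head.
  - by exists j; rewrite // inE js orbT.
  - rewrite inE => /orP[/eqP->|js] yE; first by left.
    by right; apply/IHs; exists j.
split=> [/memE[i _ ->]|[i yE]]; first by exists i.
by apply/memE; exists i; rewrite ?mem_enum.
Qed.

(** Transition [i] constrains only state [i] and letter [i], so witnesses chosen independently at
    each position already form a run. *)
Lemma eso_automaton_accepts (srt : finType) (Sg : signature srt)
    (Phi : eso_sentence Sg) (D : domain srt) n
    (sigma : n.-tuple (interpretation Sg D)) :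
  (forall i, eso_models (Structure (tnth sigma i)) Phi) ->
  accepts (eso_automaton Phi) [seq Structure J | J <- sigma].
Proof.
(* Positions form a finite type, so choosing a witness at each of them needs no choice axiom. *)
move=> /fin_all_exists[P satP].
pose Ga := sig_preds (@eso_arity _ _ Phi).
(* A run has one state more than the word has letters; [P0] fills the last place, which is never the
   current state of a transition. *)
pose P0 : interpretation Ga D :=
  @Interpretation srt Ga D (fun f => match f with end) (fun _ _ => False).
pose rho : n.+1.-tuple (interpretation Ga D) :=
  mktuple (fun i : 'I_n.+1 => if insub (val i) is Some j then P j else P0).
have runP : is_run (A := eso_automaton Phi) [seq Structure J | J <- sigma]
    [seq Structure J | J <- rho].
  (* The state signature has no function symbols and only non-rigid predicates, so states may vary
     freely along the run. *)
  exists D, n, sigma, rho; do 4?split=> //; first by case.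
  (* [widen_ord] keeps the value of [i], which is below [n], so [insub] gives back [i] and the
     current state is [P i]. *)
  move=> i; apply/models_eso_step; rewrite tnth_mktuple /= valK.
  exact: satP.
(* Acceptance asks for a run of the form [rcons r M]; the length [n.+1] rules out the empty list. *)
have : size [seq Structure J | J <- rho] = n.+1 by rewrite size_map size_tuple.
case/lastP: [seq Structure J | J <- rho] runP => // r M runP _.
by exists r, M; split=> //; case.
Qed.

(** Conversely, the current state of transition [i] in an accepting run is itself a second-order
    witness for letter [i]. *)
Lemma accepts_eso_models (srt : finType) (Sg : signature srt)
    (Phi : eso_sentence Sg) (w : seq (structure Sg)) :
  accepts (eso_automaton Phi) w -> forall M, List.In M w -> eso_models M Phi.
Proof.
move=> [r [N [[D [n [sigma [rho [-> [_ [_ [_ stepP]]]]]]]] _]]] M.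
move=> /In_map_tnth[i ->]; exists (tnth rho (widen_ord (leqnSn n) i)).
exact/models_eso_step/stepP.
Qed.

Theorem theorem3 (srt : finType) (Sg : signature srt) (T : theory Sg)
    (C : structure Sg -> Prop) :
  eso_definable C -> regular T (class_language T C).
Proof.
move=> [Phi CE]; exists (eso_automaton Phi) => w.
split=> -[wT wP]; split=> //.
  (* Being a word supplies the common domain and the tuple of letters over which the run is
     built. *)
  have [_ [D [n [sigma [wE _]]]]] := wT; rewrite wE in wP *.
  apply: eso_automaton_accepts => i; apply/CE/wP/In_map_tnth.
  by exists i.
by move=> M Mw; apply/CE/(accepts_eso_models wP).
Qed.
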